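(* Let $F$ satisfy the DLRA assumptions and the affine assumption described in the context, and let $E_n^k = X_n - Y_n^k$ be the error of low-rank Parareal with coarse rank $q$, fine rank $r$ ($q<r$) and step size $h$. Put $$\alpha = e^{\ell h} C_{r,q},\qquad \beta = e^{\ell h} C_q,\qquad \kappa = e^{\ell h}\max_{n\ge 0}\|X_n-\mathcal{T}_r(X_n)\| + (2\varepsilon_q+\varepsilon_r)\int_0^h e^{\ell(h-s)}\,ds .$$ If $\alpha+\beta<1$, then the error of low-rank Parareal satisfies for all $n,k\in\mathbb{N}$ the bound $$\|E_n^k\| \le \frac{\alpha^k}{(k-1)!}\,\frac{\prod_{j=2}^k (n-j)}{1-\beta}\,\max_{n\ge 0}\|E_n^0\| + \frac{\kappa}{1-\alpha-\beta}.$$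
   Context: Notation: $\|\cdot\|$ is the Frobenius norm on $\mathbb{R}^{m\times m}$ and $\langle\cdot,\cdot\rangle$ the corresponding inner product. A superscript $k$ on $Y,E$ is an iteration index, not a power; $\alpha^k$ denotes a power. Full problem: $\dot X(t)=F(X(t))$ on $[0,T]$, $X(0)=X_0\in\mathbb{R}^{m\times m}$, with constant time step $h$, $T=Nh$, $t_n=nh$ and $X_n=X(t_n)$. The index $n$ is the time-step index. Affine assumption: $F$ is affine linear and autonomous, $F(X)=A(X)+B$ with $A:\mathbb{R}^{m\times m}\to\mathbb{R}^{m\times m}$ a linear operator and $B\in\mathbb{R}^{m\times m}$. DLRA: for a rank $p$, let $\mathcal{M}_p$ be the manifold of $m\times m$ matrices of rank $p$, and for $Y\in\mathcal{M}_p$ let $\mathcal{P}_Y$ be the $l_2$-orthogonal projection onto the tangent space of $\mathcal{M}_p$ at $Y$. The dynamical low-rank approximation (DLRA) of rank $p$ is the solution of $\dot Y(t)=\mathcal{P}_{Y(t)}F(Y(t))$ with initial value in $\mathcal{M}_p$; $\psi_p^h(Z)$ denotes this solution at time $h$ with initial value $Z$. $\mathcal{T}_p$ denotes the orthogonal projection onto $\mathcal{M}_p$ (truncated SVD). DLRA assumptions: for all $X,Y\in\mathbb{R}^{m\times m}$, $\|F(X)-F(Y)\|\le L\|X-Y\|$ (Lipschitz with constant $L$) and $\langle X-Y,F(X)-F(Y)\rangle\le \ell\|X-Y\|^2$ (one-sided Lipschitz with constant $\ell$); and, for $p\in\{q,r\}$, $\|F(Y)-\mathcal{P}_YF(Y)\|\le\varepsilon_p$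 for $Y\in\mathcal{M}_p$ (modeling error). Low-rank Parareal: for ranks $q<r$ and a given initial matrix $Y_0$, the iterates $Y_n^k$ are defined by $Y_0^k=Y_0$; $Y_{n+1}^0=\psi_q^h(\mathcal{T}_q(Y_n^0))+\mathcal{E}_n$, where the matrices $\mathcal{E}_n$ are small perturbations such that $\mathrm{rank}(Y_{n+1}^0)=r+2q$ and can be chosen randomly; and $$Y_{n+1}^{k+1}=\psi_r^h(\mathcal{T}_r(Y_n^k))+\psi_q^h(\mathcal{T}_q(Y_n^{k+1}))-\psi_q^h(\mathcal{T}_q(Y_n^k)).$$ Lipschitz constants: $C_{r,q}$ and $C_q$ are the Lipschitz constants of $\mathcal{T}_r-\mathcal{T}_q$ and of $\mathcal{T}_q$, respectively.
   Formalization: Adds the assumption ‖X_0−Y_0‖ ≤ κ/(1−α−β) (true if Y_0=X_0, and forced by the bound at n=0, k=2), takes k≥1, and reads ∏(n−j) as 0 when k≥2 and n≤k, since for n<2 the literal product can be negative. *)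

(* Defs.v *)
From HB Require Import structures.
From mathcomp Require Import all_boot all_order all_algebra.
From mathcomp Require Import all_classical all_reals all_analysis.
Import Order.TTheory GRing.Theory Num.Theory.
Import numFieldNormedType.Exports.

Set Implicit Arguments.
Unset Strict Implicit.
Unset Printing Implicit Defensive.

Local Open Scope classical_set_scope.
Local Open Scope ring_scope.

Section LowRank.
Context {R : realType} {m : nat}.
Implicit Types (X Y Z W U V : 'M[R]_m) (F f : 'M[R]_m -> 'M[R]_m) (p : nat).

Definition frob_inner X Y : R := \tr (X^T *m Y).

(* The library norm on matrices is the maximum of the entries; it induces the
   same topology, so only the metric estimates below need this norm. *)
Definition frob X : R := Num.sqrt (frob_inner X X).

Definition frob_lipschitz (D : set 'M[R]_m) (C : R) f : Prop :=
  0 <= C /\ forall X Y, D X -> D Y -> frob (f X - f Y) <= C * frob (X - Y).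

Definition affine_map F : Prop :=
  exists (A : {linear 'M[R]_m -> 'M[R]_m}) (B : 'M[R]_m),
    forall X, F X = A X + B.

(* Classical solution of X' = F(X) on [0, a]. *)
Definition solves_ode F (a : R) (X : R -> 'M[R]_m) : Prop :=
  {within `[0, a], continuous X} /\
  forall t : R, 0 < t < a -> is_derive t (1 : R) X (F (X t)).

Definition fixed_rank p : set 'M[R]_m := [set Y | \rank Y = p].

(* Velocities at Y of the curves in the manifold of rank-p matrices. *)
Definition tangent_space p Y : set 'M[R]_m :=
  [set V | exists g : R -> 'M[R]_m,
     [/\ \forall t \near (0 : R), fixed_rank p (g t),
         g 0 = Y & is_derive (0 : R) (1 : R) g V]].

Definition tangent_proj p Y Z : 'M[R]_m :=
  xget 0 [set W | tangent_space p Y W /\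
                  forall V, tangent_space p Y V -> frob_inner (Z - W) V = 0].

Definition dlra_reaches F p (h : R) Z W : Prop :=
  exists Y : R -> 'M[R]_m,
    [/\ solves_ode (fun U => tangent_proj p U (F U)) h Y,
        forall t : R, 0 <= t <= h -> fixed_rank p (Y t),
        Y 0 = Z & Y h = W].

(* The DLRA flow is only partially defined, since the solution may leave the
   manifold before time h; [dlra_flow] is 0 where [dlra_defined] fails. *)
Definition dlra_defined F p (h : R) Z : Prop := exists W, dlra_reaches F p h Z W.

Definition dlra_flow F p (h : R) Z : 'M[R]_m := xget 0 (dlra_reaches F p h Z).

(* W is a rank-p truncated SVD of Z. It is unique only if there is a gap
   between the p-th and the (p+1)-th singular values, hence a relation. *)
Definition truncated_svd p Z W : Prop :=
  exists (U V : 'M[R]_m) (s : 'rV[R]_m),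
    [/\ U^T *m U = 1%:M, V^T *m V = 1%:M,
        (forall i, 0 <= s 0 i) /\
        (forall i j : 'I_m, (i <= j)%N -> s 0 j <= s 0 i),
        Z = U *m diag_mx s *m V^T &
        W = U *m diag_mx (\row_i (if (i < p)%N then s 0 i else 0)) *m V^T].

Definition modeling_error_le F p (eps : R) : Prop :=
  forall Y, fixed_rank p Y -> frob (F Y - tangent_proj p Y (F Y)) <= eps.

Record dlra_assumptions F (q r : nat) (L ell eps_q eps_r : R) : Prop := {
  dlra_lipschitz : forall X Y, frob (F X - F Y) <= L * frob (X - Y);
  dlra_one_sided : forall X Y,
    frob_inner (X - Y) (F X - F Y) <= ell * frob (X - Y) ^+ 2;
  dlra_modeling_q : modeling_error_le F q eps_q;
  dlra_modeling_r : modeling_error_le F r eps_r }.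

(* [Y n k] is the k-th iterate at time step n, and [T p] is the truncation
   to rank p. *)
Record low_rank_parareal F (T : nat -> 'M[R]_m -> 'M[R]_m) (q r : nat) (h : R)
    (N : nat) (Y0 : 'M[R]_m) (P : nat -> 'M[R]_m) (Y : nat -> nat -> 'M[R]_m)
    : Prop := {
  parareal_defined : forall n k, (n < N)%N ->
    dlra_defined F q h (T q (Y n k)) /\ dlra_defined F r h (T r (Y n k));
  parareal_start : forall k, Y 0%N k = Y0;
  parareal_coarse : forall n, (n < N)%N ->
    Y n.+1 0%N = dlra_flow F q h (T q (Y n 0%N)) + P n;
  parareal_rank : forall n, (n < N)%N -> \rank (Y n.+1 0%N) = (r + 2 * q)%N;
  parareal_step : forall n k, (n < N)%N ->
    Y n.+1 k.+1 = dlra_flow F r h (T r (Y n k))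
                  + dlra_flow F q h (T q (Y n k.+1))
                  - dlra_flow F q h (T q (Y n k)) }.

End LowRank.

(* Pitfall: the subtraction is truncated, so the product is 0 for
   2 <= k and n <= k, as it should be: no coarse error is left after n
   iterations. For 2 <= n this is the product over the reals, see
   [falling_prodE]; for n < 2 the latter has nonzero factors of alternating
   sign and can make an error bound negative. *)
Definition falling_prod (n k : nat) : nat := (\prod_(2 <= j < k.+1) (n - j))%N.

Lemma falling_prodE (R : realType) (n k : nat) : (2 <= n)%N ->
  (falling_prod n k)%:R = \prod_(2 <= j < k.+1) (n%:R - j%:R) :> R.
Proof.
move=> n2; rewrite /falling_prod.
have [kn|nk] := leqP k n.
  rewrite natr_prod; apply: eq_big_nat => j /andP[_ jk].
  by rewrite natrB // (leq_trans _ kn).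
rewrite natr_prod ![\prod_(2 <= j < k.+1) _](@big_cat_nat _ _ _ n) //=;
  try exact: leqW (ltnW nk).
rewrite ![\prod_(n <= j < k.+1) _]big_ltn ?ltnS ?(ltnW nk) //.
by rewrite subnn subrr !mul0r !mulr0.
Qed.

(* Main.v *)
Require Import Defs.
From HB Require Import structures.
From mathcomp Require Import all_boot all_order all_algebra.
From mathcomp Require Import all_classical all_reals all_analysis.
From mathcomp Require Import ring lra.
Import Order.TTheory GRing.Theory Num.Theory.
Import numFieldNormedType.Exports.

Set Implicit Arguments.
Unset Strict Implicit.
Unset Printing Implicit Defensive.

Local Open Scope classical_set_scope.
Local Open Scope ring_scope.

(** Why the theorem holds.

    Write e(n,k) for the norm of the error. One step of the iteration is a
    signed combination of three low-rank flows with weights 1, 1 and -1, so on a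
    single time interval the error is the end value of
      W(s) = X(t_n + s) - Y_r(s) - Y_1(s) + Y_0(s),
    where Y_r, Y_1, Y_0 are the three projected solution curves. The weights
    1, -1, -1, 1 sum to zero, so for F = A + B the constant B cancels and
      W' = A W + delta,  |delta| <= eps_r + 2 eps_q,
    delta collecting the three modeling errors. Since the one-sided Lipschitz
    condition reads <Z, A Z> <= ell |Z|^2, a Gronwall estimate on W
    ([frob_gronwall], applied in [affine_dlra_defect]) bounds |W(h)| by
    e^(ell h) |W(0)| plus the accumulated modeling errors.

    The initial value W(0) = X_n - T_r Y_n^k - T_q Y_n^{k+1} + T_q Y_n^k splits
    into X_n - T_r X_n, an increment of T_r - T_q from Y_n^k to X_n, and an
    increment of T_q from Y_n^{k+1} to X_n. This gives the scalar recursion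
      e(n+1,k+1) <= alpha e(n,k) + beta e(n,k+1) + kappa.
    Subtracting its fixed point kappa / (1 - alpha - beta) makes it homogeneous,
    with nonpositive data at n = 0. Then
      e(n,k) - kappa / (1 - alpha - beta)
        <= alpha^k / (1 - beta) * binomial(n-2, k-1) * max_i e(i,0)
    follows by induction from the rule of Pascal ([recursion_bound]), and the
    binomial is the product of the statement divided by (k-1)!
    ([falling_prod_bin]). *)

(** * The Frobenius inner product *)

Section Frobenius.
Context {R : realType} {m : nat}.
Implicit Types (X Y Z : 'M[R]_m) (c : R).

Lemma frob_innerE X Y : frob_inner X Y = \sum_i \sum_j X j i * Y j i.
Proof.
rewrite /frob_inner /mxtrace; apply: eq_bigr => i _.
by rewrite mxE; apply: eq_bigr => j _; rewrite mxE.
Qed.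

Lemma frob_innerC X Y : frob_inner X Y = frob_inner Y X.
Proof. by rewrite /frob_inner -mxtrace_tr trmx_mul trmxK. Qed.

Lemma frob_innerDr X Y Z :
  frob_inner X (Y + Z) = frob_inner X Y + frob_inner X Z.
Proof. by rewrite /frob_inner mulmxDr mxtraceD. Qed.

Lemma frob_innerNr X Y : frob_inner X (- Y) = - frob_inner X Y.
Proof. by rewrite /frob_inner mulmxN raddfN. Qed.

Lemma frob_innerZr c X Y : frob_inner X (c *: Y) = c * frob_inner X Y.
Proof. by rewrite /frob_inner -scalemxAr mxtraceZ. Qed.

Lemma frob_inner_ge0 X : 0 <= frob_inner X X.
Proof.
by rewrite frob_innerE; do 2!apply: sumr_ge0 => ? _; rewrite -expr2 sqr_ge0.
Qed.

Lemma frob_inner_eq0 X : frob_inner X X = 0 -> X = 0.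
Proof.
rewrite frob_innerE => X0; apply/matrixP => i j; rewrite mxE.
have sq_ge0 k l : 0 <= X l k * X l k by rewrite -expr2 sqr_ge0.
have {}X0 : \sum_k X k j * X k j = 0.
  by apply: (psumr_eq0P _ X0) => // k _; apply: sumr_ge0.
have /eqP : X i j * X i j = 0 by apply: (psumr_eq0P _ X0).
by rewrite mulf_eq0 orbb => /eqP.
Qed.

Lemma frob_ge0 X : 0 <= frob X. Proof. exact: sqrtr_ge0. Qed.

Lemma frob_sqr X : frob X ^+ 2 = frob_inner X X.
Proof. by rewrite sqr_sqrtr ?frob_inner_ge0. Qed.

Lemma frobN X : frob (- X) = frob X.
Proof. by rewrite /frob frob_innerNr frob_innerC frob_innerNr opprK. Qed.

(** The squared norm of |Y| X - |X| Y, which is nonnegative, expands to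
    2 |X| |Y| (|X| |Y| - <X, Y>). *)
Lemma frob_cauchy_schwarz X Y : frob_inner X Y <= frob X * frob Y.
Proof.
have [X0|Xn0] := eqVneq (frob X) 0.
  have -> : X = 0 by apply: frob_inner_eq0; rewrite -frob_sqr X0 expr0n.
  by rewrite /frob_inner trmx0 mul0mx raddf0 mulr_ge0 ?frob_ge0.
have [Y0|Yn0] := eqVneq (frob Y) 0.
  have -> : Y = 0 by apply: frob_inner_eq0; rewrite -frob_sqr Y0 expr0n.
  by rewrite /frob_inner mulmx0 raddf0 mulr_ge0 ?frob_ge0.
have XY_gt0 : 0 < frob X * frob Y by rewrite mulr_gt0 ?lt_def ?frob_ge0 ?andbT.
have := frob_inner_ge0 (frob Y *: X + - (frob X *: Y)).
rewrite frob_innerDr frob_innerNr !frob_innerZr.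
rewrite ![frob_inner (_ + _) _]frob_innerC !frob_innerDr !frob_innerNr.
rewrite !frob_innerZr -!frob_sqr (frob_innerC Y X) => sq_ge0.
rewrite -(ler_pM2l XY_gt0); lra.
Qed.

Lemma frobD X Y : frob (X + Y) <= frob X + frob Y.
Proof.
rewrite -(@ler_pXn2r _ 2) ?nnegrE ?addr_ge0 ?frob_ge0// frob_sqr sqrrD.
rewrite frob_innerDr ![frob_inner (_ + _) _]frob_innerC !frob_innerDr.
rewrite (frob_innerC Y X) !frob_sqr.
have := frob_cauchy_schwarz X Y; lra.
Qed.

End Frobenius.

(** * Curves of matrices *)

Section MatrixCurves.
Context {R : realType} {m : nat}.
Implicit Types (W : R -> 'M[R]_m).

Lemma is_derive_coord W s V i j :
  is_derive s (1 : R) W V -> is_derive s (1 : R) (fun t => W t i j) (V i j).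
Proof.
move=> [dW <-]; have dWij := (derivable_mxP _ _ _).1 dW i j.
by apply: DeriveDef => //; rewrite derive_mx// mxE.
Qed.

(** Unlike the norm, its square remains differentiable where the curve meets 0,
    so this is the form in which the Gronwall estimate differentiates it. *)
Lemma is_derive_frob_sqr W s V : is_derive s (1 : R) W V ->
  is_derive s (1 : R) (fun t => frob_inner (W t) (W t))
    (2 * frob_inner (W s) V).
Proof.
move=> dW.
have -> : (fun t => frob_inner (W t) (W t)) =
    \sum_i \sum_j (fun t => W t j i) ^+ 2.
  apply/funext => t; rewrite frob_innerE fct_sumE; apply: eq_bigr => i _.
  by rewrite fct_sumE; apply: eq_bigr => j _; rewrite -expr2.
rewrite frob_innerE mulr_sumr; apply: is_derive_sum => i.
rewrite mulr_sumr; apply: is_derive_sum => j.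
apply: is_derive_eq; first exact/is_deriveX/is_derive_coord.
by rewrite expr1 /GRing.scale/= mulrA.
Qed.

Lemma is_derive_translate W (a s : R) V : is_derive (a + s) (1 : R) W V ->
  is_derive s (1 : R) (fun t => W (a + t)) V.
Proof.
move=> [dW <-].
have shiftE : (fun t => t^-1 *: (((fun t => W (a + t)) \o shift s) (t *: (1 : R))
      - W (a + s)))
    = fun t => t^-1 *: ((W \o shift (a + s)) (t *: (1 : R)) - W (a + s)).
  by apply/funext => t /=; rewrite addrCA.
by apply: DeriveDef; rewrite /derivable /derive shiftE.
Qed.

Lemma within_continuous_translate W (a b c : R) :
  {within `[a + b, a + c], continuous W} ->
  {within `[b, c], continuous (fun t => W (a + t))}.
Proof.
move=> /subspace_continuousP cW; apply/subspace_continuousP => x bxc.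
have abxc : `[a + b, a + c]%classic (a + x).
  by move: bxc; rewrite /= !in_itv/= !lerD2l.
apply: cvg_comp (cW _ abxc) => U /=.
rewrite !nbhs_simpl /within/= => nU.
have : (a + t) @[t --> x] --> a + x by apply: cvgD; [exact: cvg_cst|exact: cvg_id].
move=> /(_ _ nU); rewrite nbhs_simpl.
apply: (@filterS _ (nbhs x)) => t /= Ut tbc; apply: Ut.
by move: tbc; rewrite /= !in_itv/= !lerD2l.
Qed.

Lemma continuous_frob_inner : continuous (fun Z : 'M[R]_m => frob_inner Z Z).
Proof.
have -> : (fun Z : 'M[R]_m => frob_inner Z Z) =
    fun Z => \sum_i \sum_j Z j i * Z j i.
  by apply/funext => Z; rewrite frob_innerE.
apply: continuous_big => [|i _]; first exact: add_continuous.
apply: continuous_big => [|j _]; first exact: add_continuous.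
move=> Z; apply: (@cvgM _ _ (nbhs Z) _ (fun Z => Z j i) (fun Z => Z j i));
  exact: coord_continuous.
Qed.

End MatrixCurves.

(** * A Gronwall estimate for the Frobenius norm *)

Section Gronwall.
Context {R : realType}.

Lemma is_derive_expR_reversed (ell h s : R) :
  is_derive s (1 : R) (fun t => expR (ell * (h - t)))
    (- ell * expR (ell * (h - s))).
Proof.
have dlin : is_derive s (1 : R) (fun t => ell * (h - t)) (- ell).
  have dh : is_derive s (1 : R) (fun t : R => h - t) (-1).
    rewrite -[X in is_derive _ _ _ X]sub0r.
    exact: (is_deriveB (is_derive_cst h s 1) (is_derive_id s 1)).
  by rewrite -mulrN1; exact: (@is_deriveZ _ _ _ _ ell _ _ _ dh).
by rewrite mulrC; exact: (is_derive1_comp (is_derive_expR _) dlin).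
Qed.

(** The antiderivative has a different form at ell = 0; existence alone lets
    the estimates below treat all signs of ell at once. *)
Lemma ex_antiderivative_expR (ell h : R) :
  exists Phi : R -> R, forall s, is_derive s (1 : R) Phi (expR (ell * (h - s))).
Proof.
have [->|ell0] := eqVneq ell 0.
  by exists id => s; rewrite mul0r expR0; exact: is_derive_id.
exists (fun s => - ell^-1 * expR (ell * (h - s))) => s.
have dexp := is_derive_expR_reversed ell h s.
apply: (is_derive_eq (is_deriveZ (- ell^-1) dexp)).
by rewrite /GRing.scale/= mulrA mulrNN mulVf// mul1r.
Qed.

Lemma continuous_expR_reversed (ell h : R) :
  continuous (fun t : R => expR (ell * (h - t))).
Proof.
move=> t; apply/differentiable_continuous/derivable1_diffP.
exact: @ex_derive (is_derive_expR_reversed ell h t).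
Qed.

Lemma Rintegral_expR_reversed (ell h : R) (Phi : R -> R) : 0 < h ->
  (forall s, is_derive s (1 : R) Phi (expR (ell * (h - s)))) ->
  \int[lebesgue_measure]_(s in `[0, h]) expR (ell * (h - s)) = Phi h - Phi 0.
Proof.
move=> h0 dPhi; rewrite /Rintegral.
have cPhi : continuous Phi.
  move=> t; apply/differentiable_continuous/derivable1_diffP.
  exact: @ex_derive (dPhi t).
rewrite (continuous_FTC2 (F := Phi) h0) ?EFinB//.
- exact/continuous_subspaceT/continuous_expR_reversed.
- split; first by move=> s _; exact: @ex_derive (dPhi s).
  + by apply: cvg_at_right_filter; exact: cPhi.
  + by apply: cvg_at_left_filter; exact: cPhi.
- by move=> s _; rewrite derive1E; exact: @derive_val (dPhi s).
Qed.

(** The growth condition says formally that u = |W| satisfies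
    u' <= ell u + eps, but u need not be differentiable where W vanishes. So u is
    replaced by v = sqrt (|W|^2 + eta^2), which satisfies
    v' <= ell v + eps + |ell| eta, and eta tends to 0. *)
Lemma frob_gronwall {m : nat} (W dW : R -> 'M[R]_m) (ell eps h : R) :
  0 < h -> 0 <= eps -> {within `[0, h], continuous W} ->
  (forall s : R, 0 < s < h -> is_derive s (1 : R) W (dW s)) ->
  (forall s : R, 0 < s < h ->
    frob_inner (W s) (dW s) <= ell * frob (W s) ^+ 2 + eps * frob (W s)) ->
  frob (W h) <= expR (ell * h) * frob (W 0)
    + eps * \int[lebesgue_measure]_(s in `[0, h]) expR (ell * (h - s)).
Proof.
move=> h0 eps0 cW derW growth.
have [Phi dPhi] := ex_antiderivative_expR ell h.
set I := Rintegral _ _ _.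
have IE : I = Phi h - Phi 0 by exact: Rintegral_expR_reversed.
have I0 : 0 <= I by apply: Rintegral_ge0 => s _; exact: expR_ge0.
have regularized (eta : R) : 0 < eta ->
    frob (W h) <= expR (ell * h) * (frob (W 0) + eta)
      + (eps + `|ell| * eta) * I.
  move=> eta0.
  pose v t := Num.sqrt (frob_inner (W t) (W t) + eta ^+ 2).
  have rad_gt0 t : 0 < frob_inner (W t) (W t) + eta ^+ 2.
    by rewrite ltr_wpDl ?frob_inner_ge0// exprn_gt0.
  have v_gt0 t : 0 < v t by rewrite sqrtr_gt0.
  have v_sqr t : v t ^+ 2 = frob (W t) ^+ 2 + eta ^+ 2.
    by rewrite frob_sqr sqr_sqrtr// ltW.
  have frob_le_v t : frob (W t) <= v t.
    by rewrite ler_sqrt ?lerDl ?sqr_ge0// ltW.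
  have eta_le_v t : eta <= v t.
    by rewrite -(@ler_pXn2r _ 2) ?nnegrE ?(ltW eta0) ?(ltW (v_gt0 t))// v_sqr
      lerDr sqr_ge0.
  have v_le t : v t <= frob (W t) + eta.
    have sum_ge0 : 0 <= frob (W t) + eta by rewrite addr_ge0 ?frob_ge0// ltW.
    rewrite -(@ler_pXn2r _ 2) ?nnegrE ?(ltW (v_gt0 t))// v_sqr sqrrD lerD2r.
    by rewrite lerDl mulrn_wge0// mulr_ge0 ?frob_ge0// ltW.
  have derv (s : R) : 0 < s < h ->
      is_derive s (1 : R) v (frob_inner (W s) (dW s) / v s).
    move=> sh.
    have drad : is_derive s (1 : R)
        (fun t => frob_inner (W t) (W t) + eta ^+ 2)
        (2 * frob_inner (W s) (dW s)).
      rewrite -[X in is_derive _ _ _ X]addr0.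
      apply: is_deriveD; exact/is_derive_frob_sqr/derW.
    have dv := @is_derive1_comp _ Num.sqrt
      (fun t => frob_inner (W t) (W t) + eta ^+ 2) s _ _
      (is_derive1_sqrt (rad_gt0 s)) drad.
    apply: (is_derive_eq dv).
    rewrite -/(v s).
    have v_neq0 : v s != 0 by rewrite gt_eqF.
    by field.
  (* Nonincreasing by the differential inequality for v; its values at 0 and h
     give the regularized bound. *)
  pose z t := expR (ell * (h - t)) * v t - (eps + `|ell| * eta) * Phi t.
  have derz (s : R) : 0 < s < h -> is_derive s (1 : R) z
      (expR (ell * (h - s)) *
        (frob_inner (W s) (dW s) / v s - ell * v s - (eps + `|ell| * eta))).
    move=> sh.
    have dprod := is_deriveM (is_derive_expR_reversed ell h s) (derv s sh).
    have dsc := is_deriveZ (eps + `|ell| * eta) (dPhi s).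
    apply: (is_derive_eq (is_deriveB dprod dsc)).
    by rewrite /GRing.scale/=; ring.
  have z_le : z h <= z 0.
    apply: (@ler0_derive1_le_cc _ z 0 h); rewrite ?in_itv/= ?lexx ?ltW//.
    - by move=> s; rewrite in_itv/= => /derz ds; exact: @ex_derive ds.
    - move=> s; rewrite in_itv/= => sh; rewrite derive1E.
      rewrite (@derive_val _ _ _ _ _ _ _ (derz s sh)).
      rewrite pmulr_rle0 ?expR_gt0// -(pmulr_lle0 _ (v_gt0 s)).
      rewrite !mulrBl divfK ?gt_eqF//.
      have frob0 := frob_ge0 (W s).
      have := growth s sh; have := v_sqr s; have := frob_le_v s.
      have := eta_le_v s; have := ler_norm (- ell); rewrite normrN.
      move: (frob_inner _ _) (frob (W s)) frob0 (v s) (v_gt0 s) => p u u0 w w0.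
      move=> abs_ell eta_w u_w w_sqr p_le.
      (* ell |W|^2 = ell v^2 - ell eta^2, and the last term is absorbed using
         eta <= v. *)
      have abs_le : - ell * eta ^+ 2 <= `|ell| * eta * w.
        rewrite expr2 mulrA (le_trans (y := `|ell| * eta * eta))//.
          by rewrite !ler_wpM2r// ltW.
        by rewrite ler_wpM2l// mulr_ge0// ltW.
      have eps_le : eps * u <= eps * w by rewrite ler_wpM2l.
      rewrite -mulrA -expr2 w_sqr; lra.
    - have czero : {within `[0, h], continuous (fun t => expR (ell * (h - t)))}.
        exact/continuous_subspaceT/continuous_expR_reversed.
      have cPhi : {within `[0, h], continuous Phi}.
        apply/continuous_subspaceT => t.
        apply/differentiable_continuous/derivable1_diffP.
        exact: @ex_derive (dPhi t).
      have cv : {within `[0, h], continuous v}.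
        apply: (@within_continuous_comp _ _ _ _ W
          (fun Z => Num.sqrt (frob_inner Z Z + eta ^+ 2))) => // Z _.
        apply: (@continuous_comp _ _ _
          (fun Z => frob_inner Z Z + eta ^+ 2) Num.sqrt); last exact: sqrt_continuous.
        apply: (@cvgD _ _ _ (nbhs Z) _ (fun Z => frob_inner Z Z)
          (cst (eta ^+ 2))); [exact: continuous_frob_inner|exact: cvg_cst].
      move=> t; apply: cvgB; first by apply: cvgM; [exact: czero|exact: cv].
      by apply: cvgM; [exact: cvg_cst|exact: cPhi].
  have : expR (ell * h) * v 0 <= expR (ell * h) * (frob (W 0) + eta).
    by rewrite ler_pM2l ?expR_gt0.
  move: z_le (frob_le_v h); rewrite /z subrr mulr0 expR0 mul1r subr0 IE; lra.
(* The coefficient of eta in the regularized bound. *)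
pose c := expR (ell * h) + `|ell| * I.
have c_gt0 : 0 < c by rewrite ltr_wpDr ?expR_gt0// mulr_ge0.
apply/ler_addgt0Pr => e e0; have := regularized (e / c) (divr_gt0 e0 c_gt0).
have : c * (e / c) = e by rewrite mulrC divfK// gt_eqF.
by rewrite /c; lra.
Qed.

End Gronwall.

(** * Cancellation of the affine flow over one time step *)

Section AffineDefect.
Context {R : realType} {m : nat}.
Implicit Types (F : 'M[R]_m -> 'M[R]_m) (X : R -> 'M[R]_m).

Lemma solves_ode_translate F X (a h b : R) : 0 <= a -> a + h <= b ->
  solves_ode F b X -> solves_ode F h (fun t => X (a + t)).
Proof.
move=> a0 ahb [cX dX]; split; last first.
  move=> t /andP[t0 th]; apply/is_derive_translate/dX.
  by rewrite ltr_wpDl//= (lt_le_trans _ ahb)// ltrD2l.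
apply: within_continuous_translate; apply: continuous_subspaceW cX => t /=.
rewrite !in_itv/= addr0 => /andP[at_ tah].
by rewrite (le_trans a0 at_) (le_trans tah ahb).
Qed.

Lemma dlra_flowP F p (h : R) Z :
  dlra_defined F p h Z -> dlra_reaches F p h Z (dlra_flow F p h Z).
Proof. by move=> [W ZW]; exact: (xgetPex _ (ex_intro _ W ZW)). Qed.

(** A rank-p matrix is required: on an empty manifold the modeling bound holds
    for every real number, negative ones included. *)
Lemma dlra_modeling_ge0 F p (h eps : R) Z : 0 < h -> dlra_defined F p h Z ->
  modeling_error_le F p eps -> 0 <= eps.
Proof.
move=> h0 [W [Y [_ rankY _ _]]] modelF.
apply: le_trans (modelF (Y 0) _); first exact: frob_ge0.
by apply: rankY; rewrite lexx ltW.
Qed.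

(** The combination of the four curves has weights of sum zero, so it solves the
    linear equation W' = A W up to the three modeling errors, each at most eps_r
    or eps_q since the curves stay on their manifolds. *)
Lemma affine_dlra_defect F (q r : nat) (L ell eps_q eps_r h : R) X
    Zr Z1 Z0 Wr W1 W0 :
  0 < h -> affine_map F -> dlra_assumptions F q r L ell eps_q eps_r ->
  solves_ode F h X ->
  dlra_reaches F r h Zr Wr ->
  dlra_reaches F q h Z1 W1 -> dlra_reaches F q h Z0 W0 ->
  frob (X h - Wr - W1 + W0) <=
    expR (ell * h) * frob (X 0 - Zr - Z1 + Z0) +
    (2 * eps_q + eps_r) *
      \int[lebesgue_measure]_(s in `[0, h]) expR (ell * (h - s)).
Proof.
move=> h0 [A [B FE]] [_ one_sided model_q model_r] [cX dX] reach_r reach_1 reach_0.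
have eps_q0 := dlra_modeling_ge0 h0 (ex_intro _ _ reach_1) model_q.
have eps_r0 := dlra_modeling_ge0 h0 (ex_intro _ _ reach_r) model_r.
case: reach_r => Yr [[cYr dYr] rankr <- <-].
case: reach_1 => Y1 [[cY1 dY1] rank1 <- <-].
case: reach_0 => Y0 [[cY0 dY0] rank0 <- <-].
pose W t := X t - Yr t - Y1 t + Y0 t.
pose Pi p Z := tangent_proj p Z (F Z).
pose dW t := F (X t) - Pi r (Yr t) - Pi q (Y1 t) + Pi q (Y0 t).
apply: (@frob_gronwall _ _ W dW) => //.
- by rewrite addr_ge0// mulr_ge0.
- move=> t; apply: cvgD; last exact: cY0.
  by apply: cvgB; [apply: cvgB; [exact: cX|exact: cYr]|exact: cY1].
- move=> s sh; apply: is_deriveD; last exact: dY0.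
  by apply: is_deriveB; [apply: is_deriveB; [exact: dX|exact: dYr]|exact: dY1].
move=> s /andP[/ltW s0 /ltW sh].
have sin : 0 <= s <= h by rewrite s0.
pose defect p Z := F Z - Pi p Z.
pose delta := defect r (Yr s) + defect q (Y1 s) + - defect q (Y0 s).
have dWE : dW s = A (W s) + delta.
  rewrite /dW /delta /W /defect !FE !raddfD !raddfN /=.
  by apply/matrixP => i j; rewrite !mxE; ring.
have delta_le : frob delta <= 2 * eps_q + eps_r.
  have := frobD (defect r (Yr s) + defect q (Y1 s)) (- defect q (Y0 s)).
  have := frobD (defect r (Yr s)) (defect q (Y1 s)).
  rewrite frobN -/delta.
  have := model_r _ (rankr s sin); have := model_q _ (rank1 s sin).
  have := model_q _ (rank0 s sin); rewrite -/(Pi _ _) /defect; lra.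
(* One-sided Lipschitz for the linear part, Cauchy-Schwarz for the rest. *)
rewrite dWE frob_innerDr lerD//.
  have := one_sided (W s) 0; rewrite !FE !subr0 linear0 add0r.
  by rewrite addrK.
rewrite (le_trans (frob_cauchy_schwarz _ _))// mulrC ler_wpM2r//.
exact: frob_ge0.
Qed.

End AffineDefect.

(** * The double recursion on the errors *)

Section Recursion.
Context {R : realType}.

(** Unrolling the recursion down to k = 0 gives a sum over lattice paths weighted
    by a and b. The bound is a supersolution of the recursion: as b < 1, its two
    terms add up to at most the next one by the rule of Pascal, and for the first
    iterate M + b M / (1 - b) = M / (1 - b). The shift n - 2 comes from the rows
    n = 0 and n = 1, where d is nonpositive for every iterate after the
    coarse one. *)
Lemma recursion_bound (a b M : R) (d : nat -> nat -> R) (N : nat) :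
  0 <= a -> 0 <= b -> b < 1 -> 0 <= M ->
  (forall k, d 0%N k <= 0) -> (forall n, (n <= N)%N -> d n 0%N <= M) ->
  (forall n k, (n < N)%N -> d n.+1 k.+1 <= a * d n k + b * d n k.+1) ->
  forall n k, (n <= N)%N -> d n k.+1 <= a ^+ k.+1 / (1 - b) * 'C(n - 2, k)%:R * M.
Proof.
move=> a0 b0 b1 M0 d0 dM rec.
have b1_gt0 : 0 < 1 - b by rewrite subr_gt0.
have bound_ge0 n k : 0 <= a ^+ k.+1 / (1 - b) * 'C(n, k)%:R * M.
  by rewrite !mulr_ge0 ?exprn_ge0 ?invr_ge0 ?ler0n// ltW.
have d1 k : (0 < N)%N -> d 1%N k.+1 <= 0.
  move=> N0; apply: le_trans (rec _ _ N0) _.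
  by rewrite -[leRHS]addr0 lerD// mulr_ge0_le0.
have d2 n k : (n.+2 <= N)%N ->
    d n.+2 k.+1 <= a ^+ k.+1 / (1 - b) * 'C(n, k)%:R * M.
  have split0 : a * M + b * (a ^+ 1 / (1 - b) * 1 * M) = a ^+ 1 / (1 - b) * 1 * M.
    by field; rewrite gt_eqF.
  elim: n k => [|n IH] k nN; apply: le_trans (rec _ _ nN) _.
    have bd_le0 : b * d 1%N k.+1 <= 0.
      by rewrite mulr_ge0_le0// d1// (leq_trans _ nN).
    case: k bd_le0 => [|k] bd_le0; last first.
      rewrite -[leRHS]addr0 lerD// (le_trans _ (bound_ge0 _ _))//.
      by rewrite mulr_ge0_le0// d1// (leq_trans _ nN).
    rewrite bin0 -split0 lerD//; first by rewrite ler_wpM2l// dM// ltnW.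
    apply: (le_trans bd_le0); rewrite mulr_ge0//.
    by have := bound_ge0 0%N 0%N; rewrite bin0.
  have := IH k (ltnW nN) => dk1.
  case: k dk1 => [|k] dk1.
    rewrite bin0 -split0 lerD// ler_wpM2l//; first by rewrite dM// ltnW.
    by move: dk1; rewrite bin0.
  have /(ler_wpM2l a0) dk := IH k (ltnW nN).
  have /(ler_wpM2l b0) := dk1.
  have /(ler_wpM2r (bound_ge0 n k.+1)) : b <= 1 := ltW b1.
  rewrite mul1r => b_le dk1'.
  rewrite binS natrD.
  apply: (le_trans (lerD dk (le_trans dk1' b_le))).
  rewrite (exprS a k.+1); move: (a ^+ k.+1) ((1 - b)^-1) => u v.
  by rewrite le_eqVlt; apply/orP; left; apply/eqP; ring.
case=> [|[|n]] k nN; last by rewrite subSS subSS subn0 d2.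
- exact: le_trans (d0 _) (bound_ge0 _ _).
- exact: le_trans (d1 _ nN) (bound_ge0 _ _).
Qed.

End Recursion.

Lemma falling_prod_bin (n k : nat) : falling_prod n k.+1 = ('C(n - 2, k) * k`!)%N.
Proof.
elim: k => [|k IH]; first by rewrite /falling_prod big_geq// bin0.
rewrite /falling_prod big_nat_recr//= -/(falling_prod n k.+1) IH.
rewrite factS mulnA [('C(_, k.+1) * _)%N]mulnC mul_bin_left.
by rewrite -subnDA add2n mulnAC [('C(_, _) * _)%N]mulnC.
Qed.

(** * Convergence of low-rank Parareal *)

Theorem theorem3p5 (R : realType) (m q r N : nat) (h : R)
    (F : 'M[R]_m -> 'M[R]_m) (L ell eps_q eps_r : R)
    (X : R -> 'M[R]_m) (T : nat -> 'M[R]_m -> 'M[R]_m)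
    (Y0 : 'M[R]_m) (P : nat -> 'M[R]_m) (Y : nat -> nat -> 'M[R]_m)
    (D : set 'M[R]_m) (C_rq C_q alpha beta kappa : R) :
  let Xs (n : nat) := X (n%:R * h) in
  let err (n k : nat) := Xs n - Y n k in
  (q < r)%N -> 0 < h ->
  affine_map F ->
  dlra_assumptions F q r L ell eps_q eps_r ->
  solves_ode F (N%:R * h) X ->
  (forall p Z, truncated_svd p Z (T p Z)) ->
  low_rank_parareal F T q r h N Y0 P Y ->
  (* C_rq and C_q are Lipschitz constants on a set D, which may be all of
     'M[R]_m, containing the exact values and the iterates *)
  (forall n, (n <= N)%N -> D (Xs n)) ->
  (forall n k, (n <= N)%N -> D (Y n k)) ->
  frob_lipschitz D C_rq (fun Z => T r Z - T q Z) ->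
  frob_lipschitz D C_q (T q) ->
  alpha = expR (ell * h) * C_rq ->
  beta = expR (ell * h) * C_q ->
  kappa = expR (ell * h) *
            \big[Num.max/0]_(n < N.+1) frob (Xs n - T r (Xs n))
          + (2 * eps_q + eps_r) *
            \int[lebesgue_measure]_(s in `[0, h]) expR (ell * (h - s)) ->
  alpha + beta < 1 ->
  (* satisfied when Y0 = X 0, and necessary: this is the bound for n = 0 *)
  frob (X 0 - Y0) <= kappa / (1 - alpha - beta) ->
  forall n k : nat, (n <= N)%N -> (1 <= k)%N ->
    frob (err n k) <=
      alpha ^+ k / (k.-1)`!%:R * ((falling_prod n k)%:R / (1 - beta))
        * \big[Num.max/0]_(i < N.+1) frob (err i 0%N)
      + kappa / (1 - alpha - beta).
Proof.
move=> Xs err qr h0 affF dlraF solX _ [defY startY coarseY _ stepY] DX DY lip_rq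
  lip_q alphaE betaE kappaE ab1 err0.
have [C_rq0 {}lip_rq] := lip_rq; have [C_q0 {}lip_q] := lip_q.
have alpha0 : 0 <= alpha by rewrite alphaE mulr_ge0// expR_ge0.
have beta0 : 0 <= beta by rewrite betaE mulr_ge0// expR_ge0.
have gap_gt0 : 0 < 1 - alpha - beta by lra.
pose trunc_err := \big[Num.max/0]_(n < N.+1) frob (Xs n - T r (Xs n)).
have propagation n k : (n < N)%N -> frob (err n.+1 k.+1) <=
    alpha * frob (err n k) + beta * frob (err n k.+1) + kappa.
  move=> nN; have nN1 := ltnW nN.
  have [def_q0 def_r] := defY n k nN; have [def_q1 _] := defY n k.+1 nN.
  have solXn : solves_ode F h (fun t => X (n%:R * h + t)).
    apply: solves_ode_translate solX; first by rewrite mulr_ge0// ltW.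
    have -> : n%:R * h + h = n.+1%:R * h by rewrite -natr1 mulrDl mul1r.
    by rewrite ler_wpM2r ?ler_nat// ltW.
  have := affine_dlra_defect h0 affF dlraF solXn (dlra_flowP def_r)
    (dlra_flowP def_q1) (dlra_flowP def_q0).
  set Wr := dlra_flow F r h _; set W1 := dlra_flow F q h _.
  set W0 := dlra_flow F q h _; set I := Rintegral _ _ _.
  rewrite addr0 -/(Xs n).
  have -> : X (n%:R * h + h) - Wr - W1 + W0 = err n.+1 k.+1.
    rewrite /err /Xs stepY// -natr1 mulrDl mul1r -/Wr -/W1 -/W0.
    by apply/matrixP => i j; rewrite !mxE; ring.
  (* Inserting T_r X_n and T_q X_n exposes the Lipschitz increments. *)
  have -> : Xs n - T r (Y n k) - T q (Y n k.+1) + T q (Y n k) =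
      (Xs n - T r (Xs n))
      + ((T r (Xs n) - T q (Xs n)) - (T r (Y n k) - T q (Y n k)))
      + (T q (Xs n) - T q (Y n k.+1)).
    by apply/matrixP => i j; rewrite !mxE; ring.
  move=> /le_trans; apply.
  rewrite kappaE -/trunc_err -/I [leRHS]addrA lerD2r alphaE betaE -!mulrA -!mulrDr.
  rewrite ler_pM2l ?expR_gt0//.
  apply: le_trans (frobD _ _) _; apply: (le_trans (lerD (frobD _ _) (lexx _))).
  have := lip_rq _ _ (DX n nN1) (DY n k nN1).
  have := lip_q _ _ (DX n nN1) (DY n k.+1 nN1).
  have : frob (Xs n - T r (Xs n)) <= trunc_err.
    exact: (le_bigmax _ (fun i : 'I_N.+1 => frob (Xs i - T r (Xs i)))
      (Ordinal (nN1 : (n < N.+1)%N))).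
  rewrite /err; lra.
(* The fixed point of e |-> alpha e + beta e + kappa. *)
set limit := kappa / (1 - alpha - beta) in err0 *.
have limit0 : 0 <= limit := le_trans (frob_ge0 _) err0.
have limitE : kappa = limit * (1 - alpha - beta) by rewrite divfK// gt_eqF.
set M := \big[Num.max/0]_(i < N.+1) frob (err i 0%N).
have M0 : 0 <= M by exact: bigmax_ge_id.
move=> n [|k] // nN _.
have err_max i : (i <= N)%N -> frob (err i 0%N) <= M.
  move=> iN; exact: (le_bigmax _ (fun i : 'I_N.+1 => frob (err i 0%N))
    (Ordinal (iN : (i < N.+1)%N))).
have := @recursion_bound _ alpha beta M (fun n k => frob (err n k) - limit) N.
have beta1 : beta < 1 by lra.
move=> /(_ alpha0 beta0 beta1 M0) bound.
rewrite -lerBlDr; apply: le_trans (bound _ _ _ _ _ nN) _.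
- by move=> j; rewrite /err /Xs mul0r startY subr_le0.
- by move=> i iN; rewrite lerBlDr (le_trans (err_max i iN))// lerDl.
- by move=> i j iN; have := propagation i j iN; rewrite limitE; lra.
rewrite falling_prod_bin natrM le_eqVlt; apply/orP; left; apply/eqP.
have k_neq0 : k`!%:R != 0 :> R by rewrite pnatr_eq0 -lt0n fact_gt0.
by rewrite /=; field; rewrite k_neq0 gt_eqF// subr_gt0.
Qed.
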